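(* Let $\mathcal{M}$ be a Minsky machine satisfying the standing assumptions below. (1) If $\mathcal{M}$ does not halt with capacity $m$, then $m<\deg(\mathbb{A}(\mathcal{M}))$. (2) If $\mathcal{M}$ does not halt, then $\mathbb{A}(\mathcal{M})$ is not finitely related.
   Context: Minsky machines. A Minsky machine $\mathcal{M}$ has states $\{0,1,\dots,N\}$ ($0$ is the halting state, $1$ the initial state), two registers $A,B$ holding values in $\mathbb{N}$, and a finite set of instructions of the forms $(i,R,j)$ and $(i,R,k,j)$ with $R\in\{A,B\}$. It acts on configurations $(s,\alpha,\beta)\in\{0,\dots,N\}\times\mathbb{N}\times\mathbb{N}$: $\mathcal{M}(i,\alpha,\beta)$ is $(j,\alpha+1,\beta)$ if $(i,A,j)\in\mathcal{M}$; $(j,\alpha,\beta+1)$ if $(i,B,j)\in\mathcal{M}$; $(j,\alpha-1,\beta)$ if $(i,A,k,j)\in\mathcal{M}$ and $\alpha\neq0$; $(j,\alpha,\beta-1)$ if $(i,B,k,j)\in\mathcal{M}$ and $\beta\ne 0$; $(k,\alpha,\beta)$ if $(i,A,k,j)\in\mathcal{M}$ and $\alpha=0$, or $(i,B,k,j)\in\mathcal{M}$ and $\beta=0$; and $(0,\alpha,\beta)$ if $i=0$. $\mathcal{M}^n$ denotes the $n$-fold composite, and $\mathcal{M}$ halts if $\mathcal{M}^n(1,0,0)$ has state $0$ for some $n$. Standing assumptions on $\mathcal{M}$: it returns both registers to $0$ before halting; it has exactly one instruction $(i,\dots)$ for each non-halting state $i$; the instruction for state $1$ has the form $(1,R,s)$;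 and in the state graph (vertices the states, an edge $i\to j$ iff $\mathcal{M}(i,\alpha,\beta)=(j,\alpha',\beta')$ for some $\alpha,\beta,\alpha',\beta'$) every state is reachable from $1$ and $0$ is reachable from every state. $\mathcal{M}$ has capacity $C$ if $C\ge\alpha+\beta$ whenever $\mathcal{M}^n(1,0,0)=(i,\alpha,\beta)$ for some $n$; it halts with capacity $C$ if it has capacity $C$ and halts. The algebra. $A(\mathcal{M})=\{\langle i,c\rangle: 0\le i\le N,\ c\in\{\bullet,\times,0,A,B\}\}$. Put $X=\{\langle i,\times\rangle\}$, $D=\{\langle i,\bullet\rangle\}$, $C=A(\mathcal{M})\setminus(X\cup D)$; $\mathrm{X}(\langle i,c\rangle)=\langle i,\times\rangle$, $\mathrm{State}(\langle i,c\rangle)=i$, $\mathrm{Content}(\langle i,c\rangle)=c$. Write ''$(i,R,\dots,j)\in\mathcal{M}$'' to mean $(i,R,j)\in\mathcal{M}$ or $(i,R,k,j)\in\mathcal{M}$ for some $k$. The operations (cases read in order, first applicable case applies): $\langle i,c\rangle\wedge\langle j,d\rangle$ is $\langle i,c\rangle$ if the two are equal, else $\langle\min(i,j),\times\rangle$. $M(x,y)$: $\langle j,R\rangle$ if $x=\langle i,\bullet\rangle, y=\langle i,0\rangle,(i,R,j)\in\mathcal{M}$; $\langle j,0\rangle$ if $x=\langle i,\bullet\rangle,y=\langle i,R\rangle,(i,R,k,j)\in\mathcal{M}$; $\langle j,\bullet\rangle$ if $x=\langle i,0\rangle,y=\langle i,\bullet\rangle,(i,R,j)\in\mathcal{M}$;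 $\langle j,\bullet\rangle$ if $x=\langle i,R\rangle,y=\langle i,\bullet\rangle,(i,R,k,j)\in\mathcal{M}$; $\langle j,c\rangle$ if $x=y=\langle i,c\rangle$, $c\ne\bullet$, $(i,R,\dots,j)\in\mathcal{M}$; $\langle j,\times\rangle$ if $\mathrm{State}(x)=\mathrm{State}(y)=i$ and $(i,R,\dots,j)\in\mathcal{M}$; otherwise $\mathrm{X}(y)$. $M'(x)$: $\langle k,c\rangle$ if $x=\langle i,c\rangle$, $(i,R,k,j)\in\mathcal{M}$, $c\neq R$; $\langle k,\times\rangle$ if $\mathrm{State}(x)=i$ and $(i,R,k,j)\in\mathcal{M}$; otherwise $\mathrm{X}(x)$. $I(x,y)$: $\langle1,\bullet\rangle$ if $x\in D$; $\langle 1,0\rangle$ if $y\in C$; otherwise $\langle1,\times\rangle$. $H(x)$: $\langle0,0\rangle$ if $x\in\{\langle0,0\rangle,\langle0,\bullet\rangle\}$, otherwise $\langle0,\times\rangle$. $N_0(x,y,z)$: $y$ if $x=\langle0,\bullet\rangle$ and $\mathrm{State}(y)=\mathrm{State}(z)$; $z$ if $x=\langle0,0\rangle$, $z\notin D$, $\mathrm{State}(y)=\mathrm{State}(z)$; otherwise $\mathrm{X}(y\wedge z)$. $S(x,y,z)$: $\langle1,0\rangle$ if $x=\langle1,0\rangle$, $\mathrm{State}(y)=\mathrm{State}(z)=1$ and $(\mathrm{Content}(y),\mathrm{Content}(z))\in\{(\bullet,0),(0,\bullet),(0,0)\}$; otherwise $\langle1,\times\rangle$. $N_\bullet(u,x,y,z)$,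 where the first four cases require $\mathrm{State}(x)=\mathrm{State}(y)=\mathrm{State}(z)$: $x$ if $x=y\notin X$; $x$ if $u\in D$, $y\in X$; $y$ if $u\in D$, $x\in X$; $z$ if $u\in D$, $z\in\{x,y\}$; otherwise $\mathrm{X}(x\wedge y\wedge z)$. $P(u,v,x,y)$: $x$ if $\mathrm{State}(u)=\mathrm{State}(v)$, else $y$. $\mathbb{A}(\mathcal{M})=\langle A(\mathcal{M});\wedge,M,M',I,H,N_0,S,N_\bullet,P\rangle$. Degree. For a set $\mathcal{R}$ of finitary relations on a finite set, $\mathrm{Pol}(\mathcal{R})$ is the set of operations preserving each member of $\mathcal{R}$. $\deg(\mathbb{A})$ is the infimum, over all sets $\mathcal{R}$ with $\mathrm{Pol}(\mathcal{R})$ equal to the clone of term operations of $\mathbb{A}$, of the supremum of arities of members of $\mathcal{R}$; $\mathbb{A}$ is finitely related if $\deg(\mathbb{A})<\infty$. Standing assumption: the subalgebra of $\mathbb{A}(\mathcal{M})$ generated by $\{\langle1,\bullet\rangle,\langle1,0\rangle\}$ contains $\langle0,\bullet\rangle$. *)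

(* Defs.v *)
From HB Require Import structures.
From mathcomp Require Import all_boot.
From mathcomp Require Import boolp.
Set Implicit Arguments.
Unset Strict Implicit.
Unset Printing Implicit Defensive.

Inductive enat := Fin of nat | Infty.

Definition enat_lt (d e : enat) : Prop :=
  match d, e with
  | Fin a, Fin b => a < b
  | Fin _, Infty => True
  | Infty, _ => False
  end.

(* The infimum in enat of [P], a set of finite values; Infty if it is empty. *)
Definition enat_least (P : nat -> Prop) : enat :=
  if pselect (exists n, `[< P n >]) is left ex then Fin (ex_minn ex) else Infty.

Definition enat_sup (S : nat -> Prop) : enat :=
  enat_least (fun b => forall k, S k -> k <= b).

(* Infty never affects an infimum, so only the finite members matter. *)
Definition enat_inf (S : enat -> Prop) : enat :=
  enat_least (fun d => S (Fin d)).

Record algebra := Algebra {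
  carrier :> finType;
  symbol : Type;
  arity : symbol -> nat;
  interp : forall s : symbol, {ffun 'I_(arity s) -> carrier} -> carrier
}.

Definition operation (T : finType) (n : nat) := {ffun 'I_n -> T} -> T.

Inductive term (A : algebra) (n : nat) :=
  | Var of 'I_n
  | App (s : symbol A) of 'I_(arity s) -> term A n.

Fixpoint eval (A : algebra) (n : nat) (t : term A n) : operation A n :=
  fun x => match t with
           | Var i => x i
           | App s ts => interp [ffun j => eval (ts j) x]
           end.

Definition term_operation (A : algebra) (n : nat) (f : operation A n) : Prop :=
  exists t : term A n, forall x, f x = eval t x.

Definition relation_set (T : finType) :=
  forall k : nat, {set {ffun 'I_k -> T}} -> Prop.

Definition preserves (T : finType) (n k : nat) (f : operation T n)
    (r : {set {ffun 'I_k -> T}}) : Prop :=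
  forall rows : 'I_n -> {ffun 'I_k -> T}, (forall i, rows i \in r) ->
    [ffun j => f [ffun i => rows i j]] \in r.

Definition Pol (T : finType) (Rs : relation_set T) (n : nat)
    (f : operation T n) : Prop :=
  forall (k : nat) (r : {set {ffun 'I_k -> T}}), Rs k r -> preserves f r.

(* Clones consist of operations of positive arity. *)
Definition determines_clone (A : algebra) (Rs : relation_set A) : Prop :=
  forall (n : nat) (f : operation A n), 0 < n ->
    Pol Rs f <-> term_operation f.

Definition sup_arity (T : finType) (Rs : relation_set T) : enat :=
  enat_sup (fun k => exists r, Rs k r).

Definition deg (A : algebra) : enat :=
  enat_inf (fun d => exists Rs : relation_set A,
    determines_clone Rs /\ sup_arity Rs = d).

Definition finitely_related (A : algebra) : Prop := enat_lt (deg A) Infty.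

Inductive generated (A : algebra) (G : A -> Prop) : A -> Prop :=
  | gen_base a : G a -> generated G a
  | gen_op (s : symbol A) (x : {ffun 'I_(arity s) -> A}) :
      (forall j, generated G (x j)) -> generated G (interp x).

Inductive reg := RA | RB.

Definition reg_to_bool (r : reg) : bool := if r is RA then true else false.
Definition bool_to_reg (b : bool) : reg := if b then RA else RB.
Lemma reg_boolK : cancel reg_to_bool bool_to_reg. Proof. by case. Qed.
HB.instance Definition _ := Countable.copy reg (can_type reg_boolK).
HB.instance Definition _ : isFinite reg := CanIsFinite reg_boolK.

(* The states are 0, ..., N with N = n.+1; N >= 1 since 1 is a state. *)
Definition state (n : nat) := 'I_n.+2.

Definition halting {n : nat} : state n := ord0.
Definition initial {n : nat} : state n := @Ordinal n.+2 1 isT.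

(* [inl (i, R, j)] is the instruction (i,R,j): add 1 to R and go to j;
   [inr (i, R, k, j)] is (i,R,k,j): go to k if R is 0, otherwise subtract 1
   from R and go to j. *)
Definition instr (n : nat) : finType :=
  (state n * reg * state n + state n * reg * state n * state n)%type.

Definition minsky (n : nat) := {set instr n}.

Definition source n (ins : instr n) : state n :=
  match ins with
  | inl (i, _, _) => i
  | inr (i, _, _, _) => i
  end.

(* The instruction of state [i], which [standing] makes unique. *)
Definition instr_at n (M : minsky n) (i : state n) : option (instr n) :=
  [pick ins in M | source ins == i].

Definition config (n : nat) := (state n * nat * nat)%type.

Definition step n (M : minsky n) (cf : config n) : config n :=
  let: (i, a, b) := cf in
  if i == halting then (halting, a, b) else
  match instr_at M i with
  | Some (inl (_, RA, j)) => (j, a.+1, b)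
  | Some (inl (_, RB, j)) => (j, a, b.+1)
  | Some (inr (_, RA, k, j)) => if a == 0 then (k, a, b) else (j, a.-1, b)
  | Some (inr (_, RB, k, j)) => if b == 0 then (k, a, b) else (j, a, b.-1)
  | None => (i, a, b)
  end.

Definition run n (M : minsky n) (t : nat) : config n :=
  iter t (step M) (initial, 0, 0).

Definition halts n (M : minsky n) : Prop :=
  exists t a b, run M t = (halting, a, b).

Definition has_capacity n (M : minsky n) (C : nat) : Prop :=
  forall t i a b, run M t = (i, a, b) -> a + b <= C.

Definition halts_with_capacity n (M : minsky n) (C : nat) : Prop :=
  has_capacity M C /\ halts M.

Definition edge n (M : minsky n) : rel (state n) :=
  [rel i j | `[< exists a b a' b', step M (i, a, b) = (j, a', b') >]].

Record standing n (M : minsky n) : Prop := Standing {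
  returns_registers_to_0 :
    forall t a b, run M t = (halting, a, b) -> a = 0 /\ b = 0;
  (* Needed for the action on configurations of state 0 to be well defined. *)
  no_halting_instruction : forall ins, ins \in M -> source ins != halting;
  one_instruction_per_state : forall i : state n, i != halting ->
    exists! ins : instr n, ins \in M /\ source ins = i;
  initial_instruction : exists (R : reg) (s : state n), inl (initial, R, s) \in M;
  reachable_from_initial : forall i : state n, connect (edge M) initial i;
  halting_reachable : forall i : state n, connect (edge M) i halting
}.

Inductive content := Dot | Cross | Zero | Reg of reg.

Definition content_code (c : content) : option (option (option reg)) :=
  match c with
  | Dot => None
  | Cross => Some None
  | Zero => Some (Some None)
  | Reg R => Some (Some (Some R))
  end.
Definition content_decode (o : option (option (option reg))) : content :=
  match o with
  | None => Dot
  | Some None => Cross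
  | Some (Some None) => Zero
  | Some (Some (Some R)) => Reg R
  end.
Lemma content_codeK : cancel content_code content_decode.
Proof. by case. Qed.
HB.instance Definition _ := Countable.copy content (can_type content_codeK).
HB.instance Definition _ : isFinite content := CanIsFinite content_codeK.

Definition elt (n : nat) : finType := (state n * content)%type.

Section MinskyAlgebra.
Context (n : nat) (M : minsky n).
Implicit Types u v x y z : elt n.

Definition State x : state n := x.1.
Definition Content x : content := x.2.
Definition inX x : bool := Content x == Cross.
Definition inD x : bool := Content x == Dot.
Definition inC x : bool := ~~ inX x && ~~ inD x.
Definition toX x : elt n := (State x, Cross).

Definition opMeet x y : elt n :=
  if x == y then x
  else (if State x <= State y then State x else State y, Cross).

Definition opM x y : elt n :=
  let c := Content x in let d := Content y in
  if State x != State y then toX y else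
  match instr_at M (State x) with
  | Some (inl (_, R, j)) =>
      if (c == Dot) && (d == Zero) then (j, Reg R)
      else if (c == Zero) && (d == Dot) then (j, Dot)
      else if (c == d) && (c != Dot) then (j, c)
      else (j, Cross)
  | Some (inr (_, R, k, j)) =>
      if (c == Dot) && (d == Reg R) then (j, Zero)
      else if (c == Reg R) && (d == Dot) then (j, Dot)
      else if (c == d) && (c != Dot) then (j, c)
      else (j, Cross)
  | None => toX y
  end.

Definition opM' x : elt n :=
  match instr_at M (State x) with
  | Some (inr (_, R, k, _)) =>
      if Content x != Reg R then (k, Content x) else (k, Cross)
  | _ => toX x
  end.

Definition opI x y : elt n :=
  if inD x then (initial, Dot)
  else if inC y then (initial, Zero)
  else (initial, Cross).

Definition opH x : elt n :=
  if (x == (halting, Zero)) || (x == (halting, Dot)) then (halting, Zero)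
  else (halting, Cross).

Definition opN0 x y z : elt n :=
  if (x == (halting, Dot)) && (State y == State z) then y
  else if [&& x == (halting, Zero), ~~ inD z & State y == State z] then z
  else toX (opMeet y z).

Definition opS x y z : elt n :=
  if [&& x == (initial, Zero), State y == initial, State z == initial &
         (Content y, Content z) \in [:: (Dot, Zero); (Zero, Dot); (Zero, Zero)]]
  then (initial, Zero)
  else (initial, Cross).

Definition opNdot u x y z : elt n :=
  if (State x == State y) && (State y == State z) then
    if (x == y) && ~~ inX x then x
    else if inD u && inX y then x
    else if inD u && inX x then y
    else if inD u && ((z == x) || (z == y)) then z
    else toX (opMeet (opMeet x y) z)
  else toX (opMeet (opMeet x y) z).

Definition opP u v x y : elt n := if State u == State v then x else y.

End MinskyAlgebra.

Inductive minsky_symbol :=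
  | SymMeet | SymM | SymM' | SymI | SymH | SymN0 | SymS | SymNdot | SymP.

Definition minsky_arity (s : minsky_symbol) : nat :=
  match s with
  | SymM' | SymH => 1
  | SymMeet | SymM | SymI => 2
  | SymN0 | SymS => 3
  | SymNdot | SymP => 4
  end.

Definition op1 (T : finType) (f : T -> T) : operation T 1 :=
  fun x => f (x ord0).
Definition op2 (T : finType) (f : T -> T -> T) : operation T 2 :=
  fun x => f (x ord0) (x (@Ordinal 2 1 isT)).
Definition op3 (T : finType) (f : T -> T -> T -> T) : operation T 3 :=
  fun x => f (x ord0) (x (@Ordinal 3 1 isT)) (x (@Ordinal 3 2 isT)).
Definition op4 (T : finType) (f : T -> T -> T -> T -> T) : operation T 4 :=
  fun x => f (x ord0) (x (@Ordinal 4 1 isT)) (x (@Ordinal 4 2 isT))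
             (x (@Ordinal 4 3 isT)).

Definition minsky_interp n (M : minsky n) (s : minsky_symbol) :
    operation (elt n) (minsky_arity s) :=
  match s with
  | SymMeet => op2 (@opMeet n)
  | SymM => op2 (opM M)
  | SymM' => op1 (opM' M)
  | SymI => op2 (@opI n)
  | SymH => op1 (@opH n)
  | SymN0 => op3 (@opN0 n)
  | SymS => op3 (@opS n)
  | SymNdot => op4 (@opNdot n)
  | SymP => op4 (@opP n)
  end.

Definition minsky_algebra n (M : minsky n) : algebra :=
  Algebra (minsky_interp M).

Definition generates_halting_dot n (M : minsky n) : Prop :=
  @generated (minsky_algebra M)
    (fun a => a = (initial, Dot) \/ a = (initial, Zero)) (halting, Dot).

(* Main.v *)
(* Let k = m+1, and for q < k let e_q be the vector of A(M)^k with <1,Dot> at q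
   and <1,Zero> elsewhere; these vectors form a symmetric matrix.

   Let f be the k-ary operation with value <1,Zero> on every e_q and on the
   all-<1,Zero> tuple, and <1,Cross> elsewhere.  A nested application of S tests
   whether x_j = <1,Zero>, all entries are <1,Zero> or <1,Dot>, and at most one
   of them is <1,Dot>; this term agrees with f except at e_j.  As m tuples always
   miss some e_j, f preserves every invariant relation of arity at most m.

   On the other hand, the subalgebra of A(M)^k generated by the e_q simulates M
   with capacity m: each of its vectors has a constant state and at most one Dot,
   and a vector without Cross has exactly one Dot and its state and numbers of
   A's and B's form a configuration that M reaches within capacity m.  This is
   an invariant because H and N_0 could only break it at a halting configuration.
   As f maps the e_q to the Dot-free vector with entries <1,Zero>, it is not a
   term operation. *)
Require Import Defs.
From HB Require Import structures.
From mathcomp Require Import all_boot.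
From mathcomp Require Import boolp.
Set Implicit Arguments.
Unset Strict Implicit.
Unset Printing Implicit Defensive.

(** * Lower bounds on the degree by local interpolation *)

Lemma enat_leastP (P : nat -> Prop) (d : nat) : enat_least P = Fin d -> P d.
Proof.
rewrite /enat_least; case: pselect => // ex [<-].
by case: ex_minnP => k /asboolP.
Qed.

Lemma sup_arity_le (T : finType) (Rs : relation_set T) (d k : nat) r :
  sup_arity Rs = Fin d -> Rs k r -> k <= d.
Proof. by move=> /enat_leastP H Hr; apply: H; exists r. Qed.

Lemma lt_deg (A : algebra) (m : nat) :
  (forall (Rs : relation_set A) d, determines_clone Rs ->
     sup_arity Rs = Fin d -> m < d) ->
  enat_lt (Fin m) (deg A).
Proof.
move=> H; case E: (deg A) => [d|] //=.
by case: (enat_leastP E) => Rs [HRs /(H _ _ HRs)].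
Qed.

(** An [l]-ary relation with [l < k] confronts [f] with only [l] argument tuples. Some [e i] is not
    among them, so on all of them [f] coincides with a single term, and terms preserve the
    relation. *)
Lemma lt_deg_interpolation (A : algebra) (m k : nat) (f : operation A k)
    (e : 'I_k -> {ffun 'I_k -> A}) :
  m < k -> injective e ->
  (forall i, exists t : term A k, forall x, x != e i -> f x = eval t x) ->
  ~ term_operation f ->
  enat_lt (Fin m) (deg A).
Proof.
move=> mk e_inj Hf Hnot; apply: lt_deg => Rs d Rs_clone Rs_sup.
rewrite ltnNge; apply/negP => dm; apply: Hnot.
have k0 : 0 < k by apply: leq_trans mk.
apply/(Rs_clone k f k0) => l r Hr rows rows_r.
have lk : l < k by apply: leq_ltn_trans (sup_arity_le Rs_sup Hr) (leq_ltn_trans dm mk).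
pose col (j : 'I_l) : {ffun 'I_k -> A} := [ffun i => rows i j].
(* Pigeonhole: [e] has [k] distinct values, [col] at most [l]. *)
have [i Hi] : exists i, e i \notin codom col.
  apply/existsP; rewrite -negb_forall; apply/negP => /forallP sub.
  have: #|codom e| <= #|codom col|.
    by apply/subset_leq_card/subsetP => _ /codomP[i ->].
  by rewrite card_codom // card_ord leqNgt (leq_ltn_trans (leq_image_card _ _)) // card_ord.
have [t Ht] := Hf i.
have t_Pol : Pol Rs (@eval A k t) by apply/Rs_clone => //; exists t.
have -> : [ffun j => f [ffun i => rows i j]]
        = [ffun j => eval t [ffun i => rows i j]].
  apply/ffunP => j; rewrite !ffunE; apply: Ht; apply: contra Hi => /eqP <-.
  exact: (codom_f col j).
exact: t_Pol Hr rows rows_r.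
Qed.

(** * Vectors that encode configurations *)

Section Simulation.
Context (n : nat) (M : minsky n) (m : nat).
Local Notation vec := {ffun 'I_m.+1 -> elt n}.
Implicit Types (u v x y z : vec) (p q : 'I_m.+1) (cf : config n).

Definition size_of cf : nat := cf.1.2 + cf.2.

(** The bound covers all earlier times too, so that reaching a halting configuration bounds the
    whole run. *)
Definition reached_within cf : Prop :=
  exists t, run M t = cf /\ forall s, s <= t -> size_of (run M s) <= m.

Lemma reached_within_step cf : reached_within cf ->
  size_of (step M cf) <= m -> reached_within (step M cf).
Proof.
move=> [t [<- cap]] le; exists t.+1; split=> // s.
by rewrite leq_eqVlt => /predU1P[->|/cap].
Qed.

(** [step] fixes halting configurations, so the bound up to time [t] persists at all later times. *)
Lemma reached_within_halting a b :
  reached_within (halting, a, b) -> halts_with_capacity M m.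
Proof.
move=> [t [Ht cap]]; split; last by exists t, a, b.
have stay s : run M (s + t) = (halting, a, b).
  by elim: s => // s; rewrite /run addSn iterS => ->.
move=> s i a' b' E; case: (leqP s t) => [/cap|lt]; first by rewrite E.
move: E; rewrite -(subnK (ltnW lt)) stay => -[_ <- <-].
by have := cap t (leqnn t); rewrite Ht.
Qed.

Definition cells v (R : reg) : {set 'I_m.+1} := [set p | Content (v p) == Reg R].

Definition config_of v : config n :=
  (State (v ord0), #|cells v RA|, #|cells v RB|).

(** The position [q] of the Dot holds no register symbol, which leaves [m] of the [m.+1]
    positions. *)
Lemma size_config_of v q : Content (v q) = Dot -> size_of (config_of v) <= m.
Proof.
move=> Dq; rewrite /size_of /= -cardsUI.
have -> : cells v RA :&: cells v RB = set0.
  by apply/setP => p; rewrite !inE; case: (Content _) => [|||[]].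
rewrite cards0 addn0; apply: (@leq_trans #|[set~ q]|).
  2: by rewrite cardsC1 card_ord.
apply/subset_leq_card/subsetP => p; rewrite !inE.
by apply: contraL => /eqP->; rewrite Dq.
Qed.

Definition crossless v : Prop := forall p, Content (v p) != Cross.

(** Uniqueness of the Dot is demanded even in the presence of a Cross: the first argument of [opI]
    or [opNdot] may contain a Cross although the result is crossless. *)
Definition simulating v : Prop :=
  [/\ forall p q, State (v p) = State (v q),
      forall p q, Content (v p) = Dot -> Content (v q) = Dot -> p = q
    & crossless v ->
      (exists q, Content (v q) = Dot) /\ reached_within (config_of v)].

Lemma simulating_crossed v q : (forall p q, State (v p) = State (v q)) ->
  (forall p q, Content (v p) = Dot -> Content (v q) = Dot -> p = q) ->
  Content (v q) = Cross -> simulating v.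
Proof. by move=> H1 H2 H3; split=> // /(_ q); rewrite H3. Qed.

Lemma simulating_reached v : simulating v -> crossless v ->
  reached_within (config_of v).
Proof. by case=> _ _ H /H[]. Qed.

Lemma simulating_nonhalting v : ~ halts_with_capacity M m ->
  simulating v -> crossless v -> State (v ord0) != halting.
Proof.
move=> nh sv cv; apply/eqP => E.
by apply/nh/reached_within_halting; rewrite -E; apply: simulating_reached.
Qed.

(** * The operations M and M' simulate machine steps *)

Lemma elt_eta (x : elt n) : x = (State x, Content x).
Proof. by case: x. Qed.

(** The cases are the possible roles of a position in an increment: the old Dot becomes a new [R],
    the Dot of the second argument replaces a Zero, and everything else is copied. *)
Lemma opM_inc i R j (a b : elt n) :
  instr_at M (State a) = Some (inl (i, R, j)) -> State a = State b ->
  Content (opM M a b) != Cross ->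
  [\/ [/\ Content a = Dot, Content b = Zero & opM M a b = (j, Reg R)],
      [/\ Content a = Zero, Content b = Dot & opM M a b = (j, Dot)]
    | [/\ Content a = Content b, Content a <> Dot, Content a <> Cross
        & opM M a b = (j, Content a)]].
Proof.
case: a b => [s c] [_ d] /= E <-; rewrite /opM /State /Content /= eqxx /= E.
case: (_ && _) / andP => [[/eqP-> /eqP->] _|_]; first by constructor 1.
case: (_ && _) / andP => [[/eqP-> /eqP->] _|_]; first by constructor 2.
case: (_ && _) / andP => [[/eqP-> /eqP Hd] /= /eqP Hc|//].
by constructor 3.
Qed.

Lemma opM_dec i R k j (a b : elt n) :
  instr_at M (State a) = Some (inr (i, R, k, j)) -> State a = State b ->
  Content (opM M a b) != Cross ->
  [\/ [/\ Content a = Dot, Content b = Reg R & opM M a b = (j, Zero)],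
      [/\ Content a = Reg R, Content b = Dot & opM M a b = (j, Dot)]
    | [/\ Content a = Content b, Content a <> Dot, Content a <> Cross
        & opM M a b = (j, Content a)]].
Proof.
case: a b => [s c] [_ d] /= E <-; rewrite /opM /State /Content /= eqxx /= E.
case: (_ && _) / andP => [[/eqP-> /eqP->] _|_]; first by constructor 1.
case: (_ && _) / andP => [[/eqP-> /eqP->] _|_]; first by constructor 2.
case: (_ && _) / andP => [[/eqP-> /eqP Hd] /= /eqP Hc|//].
by constructor 3.
Qed.

(** A Dot in the result is never written over the old Dot and never copied, so it comes from the
    second argument. *)
Lemma opM_Dot (a b : elt n) : Content (opM M a b) = Dot -> Content b = Dot.
Proof.
rewrite /opM; case: ifP => // _.
case: instr_at => [[[[i R] j]|[[[i R] k] j]]|] //=;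
  by do 3?[case: ifP => [/andP[/eqP ? /eqP ?]|_] //=]; move=> Ha; congruence.
Qed.

Lemma State_opM (a b a' b' : elt n) : State a = State a' -> State b = State b' ->
  State (opM M a b) = State (opM M a' b').
Proof.
rewrite /opM /toX => <- <-; case: ifP => // _.
case: instr_at => [[[[i R] j]|[[[i R] k] j]]|] //=;
  by rewrite !(fun_if (@State n)) /= !if_same.
Qed.

Lemma simulating_M x y : ~ halts_with_capacity M m ->
  simulating x -> simulating y ->
  simulating [ffun p => opM M (x p) (y p)].
Proof.
move=> nh sx sy; have [xS xD xC] := sx; have [yS yD yC] := sy.
set r := finfun _; have rE p : r p = opM M (x p) (y p) by rewrite ffunE.
split=> [p q|p q|cr].
- by rewrite !rE; apply: State_opM.
- by rewrite !rE => /opM_Dot Dp /opM_Dot; apply: yD.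
have c p : Content (opM M (x p) (y p)) != Cross by rewrite -rE.
have eS p : State (x p) = State (y p).
  by apply/eqP; move: (c p); rewrite {1}/opM; case: ifP => // /negbFE.
case E: (instr_at M (State (x ord0))) => [ins|]; last first.
  by move: (c ord0); rewrite /opM (eS ord0) eqxx /= -(eS ord0) E.
have Ep p : instr_at M (State (x p)) = Some ins by rewrite (xS p ord0).
case: ins {E} Ep => [[[i R] j]|[[[i R] k] j]] E.
- have H p := opM_inc (E p) (eS p) (c p).
  have cx : crossless x by move=> p; case: (H p) => [[->]|[->]|[_ _ /eqP]].
  have cy : crossless y.
    by move=> p; case: (H p) => [[_ ->]|[_ ->]|[<- _ /eqP]].
  have [[p0 Dp0] rx] := xC cx; have [[q0 Dq0] _] := yC cy.
  have Dr : Content (r q0) = Dot.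
    by rewrite rE; case: (H q0) => [[]|[_ _ ->]|[]] //; congruence.
  split; first by exists q0.
  (* The capacity bound for the new configuration is automatic, since [r] contains a Dot. *)
  suff Er : config_of r = step M (config_of x).
    by rewrite Er; apply: reached_within_step rx _; rewrite -Er; apply: size_config_of Dr.
  have cR : cells r R = p0 |: cells x R.
    apply/setP => p; rewrite !inE rE; have [->|np] := eqVneq p p0.
      by case: (H p0) => [[_ _ ->]|[]|[]]; rewrite ?Dp0 //= eqxx.
    by case: (H p) => [[/xD/(_ Dp0)/eqP]|[-> _ ->]|[_ _ _ ->]] //; rewrite (negPf np).
  have cR' R' : R' != R -> cells r R' = cells x R'.
    move=> nR; apply/setP => p; rewrite !inE rE.
    case: (H p) => [[-> _ ->]|[-> _ ->]|[_ _ _ ->]] //=.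
    by apply/negP => /eqP[/esym/eqP]; rewrite (negPf nR).
  have p0R : p0 \notin cells x R by rewrite inE Dp0.
  have Sr : State (r ord0) = j by rewrite rE; case: (H ord0) => [[_ _ ->]|[_ _ ->]|[_ _ _ ->]].
  rewrite /step {2}/config_of (negPf (simulating_nonhalting nh sx cx)) E /config_of Sr.
  by case: R cR cR' p0R {E H} => cR cR' p0R; rewrite cR cR' // cardsU1 p0R add1n.
- have H p := opM_dec (E p) (eS p) (c p).
  have cx : crossless x by move=> p; case: (H p) => [[->]|[->]|[_ _ /eqP]].
  have cy : crossless y.
    by move=> p; case: (H p) => [[_ ->]|[_ ->]|[<- _ /eqP]].
  have [[p0 Dp0] rx] := xC cx; have [[q0 Dq0] _] := yC cy.
  (* The Dot of [y] must sit on an [R] of [x]. Hence the register is nonzero, and this [R] is the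
     one consumed. *)
  have [Dx Dr] : Content (x q0) = Reg R /\ Content (r q0) = Dot.
    by rewrite rE; case: (H q0) => [[]|[-> _ ->]|[]] //; congruence.
  split; first by exists q0.
  suff Er : config_of r = step M (config_of x).
    by rewrite Er; apply: reached_within_step rx _; rewrite -Er; apply: size_config_of Dr.
  have cR : cells r R = cells x R :\ q0.
    apply/setP => p; rewrite !inE; have [->|np] := eqVneq p q0; first by rewrite Dr.
    rewrite rE; case: (H p) => [[-> _ ->]|[_ /yD/(_ Dq0)/eqP]|[_ _ _ ->]] //.
    by rewrite (negPf np).
  have cR' R' : R' != R -> cells r R' = cells x R'.
    move=> nR; apply/setP => p; rewrite !inE rE.
    case: (H p) => [[-> _ ->]|[-> _ ->]|[_ _ _ ->]] //=.
    by apply/esym/negP => /eqP[/esym/eqP]; rewrite (negPf nR).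
  (* The successor form selects the nonzero branch of [step]. *)
  have cD : #|cells x R| = #|cells x R :\ q0|.+1.
    by rewrite (cardsD1 q0) inE Dx eqxx.
  have Sr : State (r ord0) = j by rewrite rE; case: (H ord0) => [[_ _ ->]|[_ _ ->]|[_ _ _ ->]].
  rewrite /step {2}/config_of (negPf (simulating_nonhalting nh sx cx)) E /config_of Sr.
  by case: R cR cR' cD {E H Dx} => cR cR' cD; rewrite cR cR' // cD.
Qed.

Lemma opM'_Dot (a : elt n) : Content (opM' M a) = Dot -> Content a = Dot.
Proof.
rewrite /opM'; case: instr_at => [[[[i R] j]|[[[i R] k] j]]|] //=.
by case: ifP.
Qed.

Lemma State_opM' (a a' : elt n) : State a = State a' ->
  State (opM' M a) = State (opM' M a').
Proof.
rewrite /opM' /toX => <-; case: instr_at => [[[[i R] j]|[[[i R] k] j]]|] //=.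
by rewrite !(fun_if (@State n)) /= !if_same.
Qed.

(** [opM'] turns every [R] into a Cross, so a crossless result certifies that the tested register is
    zero. *)
Lemma simulating_M' x : ~ halts_with_capacity M m ->
  simulating x -> simulating [ffun p => opM' M (x p)].
Proof.
move=> nh sx; have [xS xD xC] := sx.
set r := finfun _; have rE p : r p = opM' M (x p) by rewrite ffunE.
split=> [p q|p q|cr].
- by rewrite !rE; apply: State_opM'.
- by rewrite !rE => /opM'_Dot Dp /opM'_Dot; apply: xD.
have c p : Content (opM' M (x p)) != Cross by rewrite -rE.
case E: (instr_at M (State (x ord0))) => [[[[i R] j]|[[[i R] k] j]]|];
  try by move: (c ord0); rewrite /opM' E.
have xR p : Content (x p) != Reg R /\ r p = (k, Content (x p)).
  by rewrite rE; move: (c p); rewrite /opM' (xS p ord0) E; case: ifP.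
have cx : crossless x by move=> p; move: (cr p); rewrite (xR p).2.
have [[q Dq] rx] := xC cx.
have Dr : Content (r q) = Dot by rewrite (xR q).2.
split; first by exists q.
suff Er : config_of r = step M (config_of x).
  by rewrite Er; apply: reached_within_step rx _; rewrite -Er; apply: size_config_of Dr.
have cells_r R' : cells r R' = cells x R'.
  by apply/setP => p; rewrite !inE (xR p).2.
have xR0 : cells x R = set0.
  by apply/setP => p; rewrite !inE; apply/negbTE; case: (xR p).
have Sr : State (r ord0) = k by rewrite (xR ord0).2.
rewrite /step {2}/config_of (negPf (simulating_nonhalting nh sx cx)) E /config_of Sr.
by rewrite !cells_r; case: R xR0 {E xR} => ->; rewrite cards0.
Qed.

(** * The remaining operations create no new crossless configuration *)

Lemma State_opMeet (a b : elt n) :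
  State (opMeet a b) = if State a <= State b then State a else State b.
Proof. by rewrite /opMeet; case: eqP => [->|//]; rewrite leqnn. Qed.

Lemma simulating_meet x y : simulating x -> simulating y ->
  simulating [ffun p => opMeet (x p) (y p)].
Proof.
move=> sx [yS _ _]; have [xS xD xC] := sx.
set r := finfun _; have rE p : r p = opMeet (x p) (y p) by rewrite ffunE.
have Sr p q : State (r p) = State (r q).
  by rewrite !rE !State_opMeet (xS p q) (yS p q).
split=> // [p q|cr].
  have D p' : Content (r p') = Dot -> Content (x p') = Dot.
    by rewrite rE /opMeet; case: ifP.
  by move=> /D Dp /D; apply: xD.
(* The meet avoids Cross only where its arguments agree. *)
have <- : x = r.
  apply/ffunP => p; have := cr p; rewrite rE /opMeet.
  by case: ifP.
by apply: xC => p; move: (cr p); rewrite rE /opMeet; case: ifP.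
Qed.

Lemma simulating_eq v x : simulating x -> (forall p, v p = x p) -> simulating v.
Proof. by move=> sx /ffunP ->. Qed.

Lemma simulating_no_Dot x : simulating x -> crossless x ->
  (forall p, Content (x p) <> Dot) -> False.
Proof. by move=> [_ _ xC] /xC[[q Dq] _] /(_ q). Qed.

Definition generator q : vec := [ffun p => (initial, if p == q then Dot else Zero)].

Lemma simulating_generator q : simulating (generator q).
Proof.
split=> [p p'|p p'|_]; rewrite ?ffunE //=.
  by rewrite /Content /=; do 2?[case: eqP => // ->].
split; first by exists q; rewrite ffunE /Content /= eqxx.
have cells0 R : cells (generator q) R = set0.
  by apply/setP => p; rewrite !inE ffunE /Content /=; case: ifP.
exists 0; split=> [|[]//].
by rewrite /config_of !cells0 cards0 ffunE.
Qed.

(** A crossless result is the generator at the Dot of [x]. If [x] had no Dot, all entries of [y]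
    would lie in C, making [y] crossless and Dot-free. *)
Lemma simulating_I x y : simulating x -> simulating y ->
  simulating [ffun p => opI (x p) (y p)].
Proof.
move=> [_ xD _] sy.
set r := finfun _; have rE p : r p = opI (x p) (y p) by rewrite ffunE.
have [/forallP cr|/forallPn[q /negPn/eqP rq]] :=
    boolP [forall p, Content (r p) != Cross].
  have [q Dq|nD] := pickP (fun p => inD (x p)).
    apply: (simulating_eq (simulating_generator q)) => p.
    move: (cr p); rewrite rE /opI ffunE; have [->|np] := eqVneq p q; first by rewrite Dq.
    case: ifP => [/eqP/xD/(_ (eqP Dq))/eqP|_]; first by rewrite (negPf np).
    by case: ifP.
  have yC p : inC (y p) by move: (cr p); rewrite rE /opI nD; case: ifP.
  by case: (simulating_no_Dot sy) => p; case/andP: (yC p) => // _ /eqP.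
have rD p : Content (r p) = Dot -> Content (x p) = Dot.
  by rewrite rE /opI; case: ifP => [/eqP|_] //; case: ifP.
apply: (simulating_crossed _ _ rq) => [p p'|p p' /rD Dp /rD]; last exact: xD.
by rewrite !rE /opI !(fun_if (@State n)) /= !if_same.
Qed.

(** Crossless results of [opH] and [opN0] would require such a first argument, which would encode a
    halting configuration. *)
Lemma simulating_halting x : ~ halts_with_capacity M m -> simulating x ->
  ~ (forall p, x p = (halting, Dot) \/ x p = (halting, Zero)).
Proof.
move=> nh sx hx.
have cx : crossless x by move=> p; case: (hx p) => ->.
have := simulating_nonhalting nh sx cx.
by case: (hx ord0) => ->.
Qed.

Lemma simulating_H x : ~ halts_with_capacity M m -> simulating x ->
  simulating [ffun p => opH (x p)].
Proof.
move=> nh sx.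
set r := finfun _; have rE p : r p = opH (x p) by rewrite ffunE.
have rD p : Content (r p) <> Dot by rewrite rE /opH; case: ifP.
split=> [p p'|p p' /rD//|cr].
  by rewrite !rE /opH !(fun_if (@State n)) /= !if_same.
case: (simulating_halting nh sx) => p; move: (cr p).
by rewrite rE /opH; case: ifP => // /orP[] /eqP; [right|left].
Qed.

Lemma simulating_N0 x y z : ~ halts_with_capacity M m ->
  simulating x -> simulating y -> simulating z ->
  simulating [ffun p => opN0 (x p) (y p) (z p)].
Proof.
move=> nh sx [yS yD _] [zS _ _].
set r := finfun _; have rE p : r p = opN0 (x p) (y p) (z p) by rewrite ffunE.
have rS p : State (r p) = State (opMeet (y p) (z p)).
  rewrite rE /opN0 State_opMeet; case: ifP => [/andP[_ /eqP->]|_].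
    by rewrite leqnn.
  case: ifP => [/and3P[_ _ /eqP->]|_]; first by rewrite leqnn.
  exact: State_opMeet.
(* The case returning [z] excludes Dots, so only [y] can supply one. *)
have rD p : Content (r p) = Dot -> Content (y p) = Dot.
  by rewrite rE /opN0; case: ifP => // _; case: ifP => // /and3P[_ /eqP].
split=> [p p'|p p' /rD Dp /rD|cr].
- by rewrite !rS !State_opMeet (yS p p') (zS p p').
- exact: yD.
case: (simulating_halting nh sx) => p; move: (cr p).
rewrite rE /opN0; case: ifP => [/andP[/eqP]|_]; first by left.
by case: ifP => // /and3P[/eqP]; right.
Qed.

(** A crossless result would force [x] to be constantly <1,0>, hence crossless without a Dot. *)
Lemma simulating_S x y z : simulating x ->
  simulating [ffun p => opS (x p) (y p) (z p)].
Proof.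
move=> sx.
set r := finfun _; have rE p : r p = opS (x p) (y p) (z p) by rewrite ffunE.
have rD p : Content (r p) <> Dot by rewrite rE /opS; case: ifP.
split=> [p p'|p p' /rD//|cr].
  by rewrite !rE /opS !(fun_if (@State n)) /= !if_same.
have xE p : x p = (initial, Zero).
  by move: (cr p); rewrite rE /opS; case: ifP => // /and4P[/eqP].
by case: (simulating_no_Dot sx) => p; rewrite xE.
Qed.

Lemma State_opNdot (u a b c : elt n) :
  State (opNdot u a b c) = State (opMeet (opMeet a b) c).
Proof.
rewrite /opNdot; case: ifP => // /andP[/eqP ab /eqP bc].
have E : State (opMeet (opMeet a b) c) = State a.
  by rewrite !State_opMeet -bc -ab !leqnn.
by rewrite E; do 4!case: ifP => _ //; rewrite -bc.
Qed.

Lemma opNdot_crossless (u a b c : elt n) :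
  Content (opNdot u a b c) != Cross ->
  (a = b /\ opNdot u a b c = a) \/
  (Content u = Dot /\ (opNdot u a b c = a \/ opNdot u a b c = b)).
Proof.
rewrite /opNdot; case: ifP => // _.
case: ifP => [/andP[/eqP-> _] _|_]; first by left.
case: ifP => [/andP[/eqP-> _] _|_]; first by right; split; [|left].
case: ifP => [/andP[/eqP-> _] _|_]; first by right; split; [|right].
by case: ifP => // /andP[/eqP-> /orP[]/eqP->] _; right; split; auto.
Qed.

(** Away from the Dot of [u], a crossless result forces [x] and [y] to agree. At that one position
    the result takes the entry of [x] or of [y], so as a whole it equals [x] or [y]. *)
Lemma simulating_Ndot u x y z :
  simulating u -> simulating x -> simulating y -> simulating z ->
  simulating [ffun p => opNdot (u p) (x p) (y p) (z p)].
Proof.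
move=> [_ uD _] sx sy [zS _ _]; have [xS xD _] := sx; have [yS yD _] := sy.
set r := finfun _.
have rE p : r p = opNdot (u p) (x p) (y p) (z p) by rewrite ffunE.
have H p : Content (r p) != Cross ->
    (x p = y p /\ r p = x p) \/ (Content (u p) = Dot /\ (r p = x p \/ r p = y p)).
  by rewrite !rE; apply: opNdot_crossless.
have [/forallP cr|/forallPn[q /negPn/eqP rq]] :=
    boolP [forall p, Content (r p) != Cross].
  have [q /eqP Dq|nD] := pickP (fun p => inD (u p)); last first.
    apply: (simulating_eq sx) => p.
    by case: (H p (cr p)) => [[]|[/eqP]] //; rewrite -[_ == _]/(inD _) nD.
  have off p : p != q -> x p = y p /\ r p = x p.
    by case: (H p (cr p)) => // -[/uD/(_ Dq)/eqP ->].
  have [e|e] : r q = x q \/ r q = y q by case: (H q (cr q)) => [[]|[]]; auto.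
    apply: (simulating_eq sx) => p.
    by have [->//|/off[]] := eqVneq p q.
  apply: (simulating_eq sy) => p.
  by have [->//|/off[<-]] := eqVneq p q.
apply: (simulating_crossed _ _ rq) => [p p'|p p' Dp Dp'].
  by rewrite !rE !State_opNdot !State_opMeet (xS p p') (yS p p') (zS p p').
(* A Dot of [r] is either common to [x] and [y] or lies at the Dot of [u]. For two Dots of [r], some
   one of [x], [y], [u] then has a Dot at both positions. *)
have D p1 : Content (r p1) = Dot ->
    (Content (x p1) = Dot /\ Content (y p1) = Dot) \/
    (Content (u p1) = Dot /\ (Content (x p1) = Dot \/ Content (y p1) = Dot)).
  move=> D1; have := H p1; rewrite D1.
  by case=> // [[<- <-]|[Du [<-|<-]]]; auto.
case: (D p Dp) (D p' Dp') => [[a b]|[a [b|b]]] [[a' b']|[a' [b'|b']]];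
  by [apply: xD | apply: yD | apply: uD].
Qed.

(** States are constant along [u] and [v], so [opP] makes the same choice at every position. *)
Lemma simulating_P u v x y :
  simulating u -> simulating v -> simulating x -> simulating y ->
  simulating [ffun p => opP (u p) (v p) (x p) (y p)].
Proof.
move=> [uS _ _] [vS _ _] sx sy.
have [e|ne] := eqVneq (State (u ord0)) (State (v ord0)).
  apply: (simulating_eq sx) => p.
  by rewrite ffunE /opP (uS p ord0) (vS p ord0) e eqxx.
apply: (simulating_eq sy) => p.
by rewrite ffunE /opP (uS p ord0) (vS p ord0) (negPf ne).
Qed.

(** * Invariance under all terms *)

Lemma simulating_interp (s : minsky_symbol) (xs : 'I_(minsky_arity s) -> vec) :
  ~ halts_with_capacity M m -> (forall i, simulating (xs i)) ->
  simulating [ffun p => minsky_interp M [ffun i => xs i p]].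
Proof.
move=> nh sxs; case: s xs sxs => xs sxs.
- by apply: (simulating_eq (simulating_meet (sxs ord0) (sxs (@Ordinal 2 1 isT)))) => p;
    rewrite !ffunE /= /op2 !ffunE.
- by apply: (simulating_eq (simulating_M nh (sxs ord0) (sxs (@Ordinal 2 1 isT)))) => p;
    rewrite !ffunE /= /op2 !ffunE.
- by apply: (simulating_eq (simulating_M' nh (sxs ord0))) => p;
    rewrite !ffunE /= /op1 !ffunE.
- by apply: (simulating_eq (simulating_I (sxs ord0) (sxs (@Ordinal 2 1 isT)))) => p;
    rewrite !ffunE /= /op2 !ffunE.
- by apply: (simulating_eq (simulating_H nh (sxs ord0))) => p;
    rewrite !ffunE /= /op1 !ffunE.
- by apply: (simulating_eq (simulating_N0 nh (sxs ord0)
      (sxs (@Ordinal 3 1 isT)) (sxs (@Ordinal 3 2 isT)))) => p;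
    rewrite !ffunE /= /op3 !ffunE.
- by apply: (simulating_eq (simulating_S (xs (@Ordinal 3 1 isT))
      (xs (@Ordinal 3 2 isT)) (sxs ord0))) => p;
    rewrite !ffunE /= /op3 !ffunE.
- by apply: (simulating_eq (simulating_Ndot (sxs ord0) (sxs (@Ordinal 4 1 isT))
      (sxs (@Ordinal 4 2 isT)) (sxs (@Ordinal 4 3 isT)))) => p;
    rewrite !ffunE /= /op4 !ffunE.
- by apply: (simulating_eq (simulating_P (sxs ord0) (sxs (@Ordinal 4 1 isT))
      (sxs (@Ordinal 4 2 isT)) (sxs (@Ordinal 4 3 isT)))) => p;
    rewrite !ffunE /= /op4 !ffunE.
Qed.

Local Notation A := (minsky_algebra M).

Lemma simulating_eval (t : term A m.+1) : ~ halts_with_capacity M m ->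
  simulating [ffun p => eval t (generator p)].
Proof.
move=> nh; elim: t => [i|s ts IH].
  apply: (simulating_eq (simulating_generator i)) => p.
  (* Symmetry of the generator matrix: entry [i] of [generator p] is entry [p] of [generator i]. *)
  by rewrite ffunE /= !ffunE eq_sym.
apply: (simulating_eq (simulating_interp nh IH)) => p; rewrite !ffunE /=.
by congr (minsky_interp _ _); apply/ffunP => i; rewrite !ffunE.
Qed.

(** * An operation that agrees with a term off each generator *)

Definition almost_term : operation A m.+1 := fun x =>
  if (x == [ffun=> (initial, Zero)]) || [exists q, x == generator q]
  then (initial, Zero) else (initial, Cross).

Lemma almost_term_not_term : ~ halts_with_capacity M m ->
  ~ term_operation almost_term.
Proof.
move=> nh [t Ht]; have st := simulating_eval t nh.
have E p : [ffun p => eval t (generator p)] p = (initial, Zero).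
  rewrite ffunE -Ht /almost_term.
  by case: ifP => // /negP[]; apply/orP; right; apply/existsP; exists p.
by case: (simulating_no_Dot st) => p; rewrite E.
Qed.

Definition term_S (t u v : term A m.+1) : term A m.+1 :=
  @App A _ SymS (fun i => nth t [:: t; u; v] i).

Lemma eval_term_S (t u v : term A m.+1) x :
  eval (term_S t u v) x = opS (eval t x) (eval u x) (eval v x).
Proof. by rewrite /= /op3 !ffunE. Qed.

(** [opS] passes <1,0> on from its first argument only if the other two pass [disjoint_dots], so
    nesting acts as conjunction. The innermost [term_S] tests whether entry [j] is <1,0>, replacing
    any other value by <1,Cross>. *)
Definition test_pairs (j : 'I_m.+1) (s : seq ('I_m.+1 * 'I_m.+1)) : term A m.+1 :=
  foldr (fun ab t => term_S t (Var A ab.1) (Var A ab.2))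
        (term_S (Var A j) (Var A j) (Var A j)) s.

Definition disjoint_dots (y z : elt n) : bool :=
  [&& State y == initial, State z == initial &
      (Content y, Content z) \in [:: (Dot, Zero); (Zero, Dot); (Zero, Zero)]].

Lemma eval_test_pairs j s x : eval (test_pairs j s) x =
  if (x j == (initial, Zero)) && all (fun ab => disjoint_dots (x ab.1) (x ab.2)) s
  then (initial, Zero) else (initial, Cross).
Proof.
elim: s => [|ab s IH]; rewrite [LHS]eval_term_S.
  by rewrite /= /opS; case: eqP => [->|].
rewrite IH /opS [all _ (_ :: _)]/=.
by case: (x j == _); case: (all _ s); rewrite /= ?eqxx ?andbT ?andbF.
Qed.

Lemma almost_term_eval j x : x != generator j ->
  almost_term x = eval (test_pairs j (enum [pred ab | ab.1 != ab.2])) x.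
Proof.
move=> xj; rewrite eval_test_pairs /almost_term; congr (if _ then _ else _).
apply/idP/andP => [/orP[/eqP->|/existsP[q /eqP xq]]|[/eqP xj0 /allP dd]].
- rewrite ffunE eqxx; split=> //; apply/allP => ab _.
  by rewrite !ffunE.
(* Among the tuples where [almost_term] is <1,0>, only [generator j] has a Dot at [j], and it is
   excluded. *)
- have jq : j != q by apply: contraNneq xj => ->; rewrite xq.
  rewrite xq ffunE (negPf jq); split=> //; apply/allP => -[a b].
  rewrite mem_enum inE /= => ab; rewrite !ffunE.
  have [aq|_] := eqVneq a q; last by case: ifP.
  by rewrite -aq eq_sym (negPf ab).
have ok a b : a != b -> disjoint_dots (x a) (x b).
  by move=> ab; apply: (dd (a, b)); rewrite mem_enum.
have [q /eqP Dq|nD] := pickP (fun q => inD (x q)); apply/orP.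
  have Sq : State (x q) = initial.
    (* Entry [j] is <1,0>, so the Dot lies elsewhere and the pair (q, j) has been tested, which
       gives the state at [q]. *)
    have qj : q != j by apply: contra_eq_neq Dq => ->; rewrite xj0.
    by case/and3P: (ok _ _ qj) => /eqP.
  right; apply/existsP; exists q; apply/eqP/ffunP => p; rewrite ffunE.
  rewrite [x p]elt_eta; have [->|pq] := eqVneq p q; first by rewrite Dq Sq.
  case/and3P: (ok _ _ pq) => /eqP-> _; rewrite Dq.
  by case: (Content _) => [|||[]].
left; apply/eqP/ffunP => p; rewrite ffunE.
have [->//|pj] := eqVneq p j.
rewrite [x p]elt_eta; case/and3P: (ok _ _ pj) => /eqP-> _.
have := nD p; rewrite /inD xj0.
by case: (Content _) => [|||[]].
Qed.

Lemma generator_inj : injective generator.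
Proof.
move=> p q /ffunP/(_ p); rewrite !ffunE eqxx.
by case: eqP.
Qed.

Lemma lt_deg_minsky : ~ halts_with_capacity M m ->
  enat_lt (Fin m) (deg (minsky_algebra M)).
Proof.
move=> nh.
apply: (@lt_deg_interpolation A m m.+1 almost_term generator) => // [|i|].
- exact: generator_inj.
- by eexists=> x; apply: almost_term_eval.
- exact: almost_term_not_term.
Qed.
End Simulation.

Theorem theorem6p3 (n : nat) (M : minsky n)
    (hM : standing M) (hgen : generates_halting_dot M) :
  (forall m : nat, ~ halts_with_capacity M m ->
     enat_lt (Fin m) (deg (minsky_algebra M))) /\
  (~ halts M -> ~ finitely_related (minsky_algebra M)).
Proof.
split=> [m|nh]; first exact: lt_deg_minsky.
rewrite /finitely_related; case E: (deg _) => [d|] // _.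
(* A finite degree [d] would exceed itself: without halting, the first part applies with [m] equal
   to [d]. *)
have : enat_lt (Fin d) (deg (minsky_algebra M)).
  by apply: lt_deg_minsky => -[_ /nh].
by rewrite E /= ltnn.
Qed.
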